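(* Let $n\ge3$ be an integer and write $n=3k+r$ with $k,r\in\mathbb{Z}_{\ge0}$ and $r<3$. Let $N=(n,n)$ and $M_n=\langle N,\,N+(3,2),\,N+(4,3),\,N+(5,3)\rangle\subset\mathbb{Z}_{\ge0}^2$, and let $$R=\big\{\big((1,0,1,1),(0,3,0,0)\big),\ \big((k+1,r,0,k),(0,0,2k+r,0)\big)\big\}.$$ Then $$\rho=\begin{cases}R & \text{if } r=0,\\ R\cup\big\{\big((k+2,0,0,k+1),(0,3-r,2k+r-1,0)\big)\big\} & \text{if } r=1,2,\end{cases}$$ is a minimal presentation of $M_n$.
   Context: $\langle v_0,v_1,v_2,v_3\rangle$ denotes the affine semigroup of all $\mathbb{Z}_{\ge0}$-linear combinations of the listed generators. The factorization homomorphism of $M_n$ is $\pi_n:\mathbb{Z}_{\ge0}^4\to M_n$, $\pi_n(z_0,z_1,z_2,z_3)=z_0N+z_1(N+(3,2))+z_2(N+(4,3))+z_3(N+(5,3))$, with kernel congruence $\ker\pi_n=\{(z,z'):\pi_n(z)=\pi_n(z')\}\subset\mathbb{Z}_{\ge0}^4\times\mathbb{Z}_{\ge0}^4$. A congruence on $\mathbb{Z}_{\ge0}^4$ is an equivalence relation closed under translation (if $(z,z')$ is in it, so is $(z+u,z'+u)$ for all $u\in\mathbb{Z}_{\ge0}^4$). A presentation of $M_n$ is a subset $\rho\subset\ker\pi_n$ such that $\ker\pi_n$ is the smallest congruence on $\mathbb{Z}_{\ge0}^4$ containing $\rho$; it is minimal if no proper subset of $\rho$ is a presentation of $M_n$.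 *)

(* Defs.v *)
From mathcomp Require Import all_boot all_order all_algebra.
From mathcomp Require Import boolp classical_sets.

Set Implicit Arguments.
Unset Strict Implicit.
Unset Printing Implicit Defensive.

Import GRing.Theory.
Local Open Scope classical_set_scope.
Local Open Scope ring_scope.

Section Presentation.
Variables (V : nmodType) (m : nat).

Definition nat_comb (v : 'I_m -> V) (z : 'rV[nat]_m) : V :=
  \sum_(i < m) v i *+ z 0 i.

Definition affine_semigroup (v : 'I_m -> V) : set V := range (nat_comb v).

(* nat_comb with its codomain restricted to the semigroup *)
Definition fact_hom (v : 'I_m -> V) (z : 'rV[nat]_m) : affine_semigroup v :=
  SigSub (mem_set (imageT (nat_comb v) z)).

Definition ker_cong (v : 'I_m -> V) : set ('rV[nat]_m * 'rV[nat]_m) :=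
  [set p | fact_hom v p.1 = fact_hom v p.2].

Definition congruence (C : set ('rV[nat]_m * 'rV[nat]_m)) : Prop :=
  [/\ forall x, C (x, x),
      forall x y, C (x, y) -> C (y, x),
      forall x y z, C (x, y) -> C (y, z) -> C (x, z)
    & forall x y u, C (x, y) -> C (x + u, y + u)].

(* [smallest congruence rho] is the intersection of all congruences containing
   rho; this intersection is itself a congruence. *)
Definition presentation (v : 'I_m -> V)
    (rho : set ('rV[nat]_m * 'rV[nat]_m)) : Prop :=
  rho `<=` ker_cong v /\ smallest congruence rho = ker_cong v.

Definition minimal_presentation (v : 'I_m -> V)
    (rho : set ('rV[nat]_m * 'rV[nat]_m)) : Prop :=
  presentation v rho /\
  forall sigma, sigma `<` rho -> ~ presentation v sigma.

End Presentation.

Definition vec4 (a b c d : nat) : 'rV[nat]_4 :=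
  \row_(i < 4) nth 0%N [:: a; b; c; d] i.

Definition Nvec (n : nat) : nat * nat := (n, n).

Definition M_gens (n : nat) (i : 'I_4) : nat * nat :=
  nth 0 [:: Nvec n; Nvec n + (3, 2)%N; Nvec n + (4, 3)%N; Nvec n + (5, 3)%N] i.

Definition R_rel (k r : nat) : set ('rV[nat]_4 * 'rV[nat]_4) :=
  [set (vec4 1 0 1 1, vec4 0 3 0 0);
       (vec4 (k + 1) r 0 k, vec4 0 0 (2 * k + r) 0)].

(* The truncated subtractions are exact, since they occur only for r = 1, 2. *)
Definition rho_rel (k r : nat) : set ('rV[nat]_4 * 'rV[nat]_4) :=
  if r == 0%N then R_rel k r
  else R_rel k r `|`
       [set (vec4 (k + 2) 0 0 (k + 1), vec4 0 (3 - r) (2 * k + r - 1) 0)].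

(* Main.v *)
Require Import Defs.
From mathcomp Require Import all_boot all_order all_algebra.
From mathcomp Require Import boolp classical_sets zify.

Set Implicit Arguments.
Unset Strict Implicit.
Unset Printing Implicit Defensive.

Import GRing.Theory.
Local Open Scope classical_set_scope.

(** Orient every relation of rho from its right side (0, *, *, 0) to its left
    side.  The three moves lower b + c at a factorization (a, b, c, d) by 2, 2k
    and 2k + 2 respectively, and k > 0 because n >= 3.  Hence every
    factorization is connected through rho to one to which no move applies
    ([reduce]).  A lattice computation shows that an element of M_n has only
    one factorization of this kind ([reduced_unique]), so two factorizations of
    the same element are connected through their common reduced form, and rho
    is a presentation.

    For minimality, the right side x of each relation dominates no side of any
    other relation.  The vectors that x does not dominate form an ideal of
    Z_{>=0}^m; collapsing this ideal to a point is a congruence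
    ([rees_congruence]) that contains all the other relations but leaves x
    alone in its class, so the given relation cannot be dropped
    ([indispensable]). *)

Lemma ker_congP (V : nmodType) m (v : 'I_m -> V) x y :
  ker_cong v (x, y) <-> nat_comb v x = nat_comb v y.
Proof.
rewrite /ker_cong /fact_hom /=; split=> [[]//|E].
exact: val_inj.
Qed.

Lemma ker_cong_congruence (V : nmodType) m (v : 'I_m -> V) :
  congruence (ker_cong v).
Proof.
split=> [x|x y|x y z|x y u]; rewrite ?ker_congP //.
- by move=> ->.
- move=> E.
  have D w : nat_comb v (w + u)%R = (nat_comb v w + nat_comb v u)%R.
    by rewrite -big_split; apply: eq_bigr => i _; rewrite mxE mulrnDr.
  by rewrite !D E.
Qed.

Lemma vec4_eta (z : 'rV[nat]_4) : exists a b c d, z = vec4 a b c d.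
Proof.
exists (z 0 0)%R, (z 0 1)%R, (z 0 2%:R)%R, (z 0 3%:R)%R.
apply/rowP => -[[|[|[|[|//]]]] i4]; rewrite mxE /=; congr (z _ _); exact: val_inj.
Qed.

Lemma vec4D a b c d a' b' c' d' :
  (vec4 a b c d + vec4 a' b' c' d')%R = vec4 (a + a') (b + b') (c + c') (d + d').
Proof. by apply/rowP => -[[|[|[|[|//]]]] i4]; rewrite !mxE. Qed.

Definition dominated m (u x : 'rV[nat]_m) := [forall i, u 0%R i <= x 0%R i].

Lemma dominated_vec4 a b c d a' b' c' d' :
  dominated (vec4 a b c d) (vec4 a' b' c' d') =
  [&& a <= a', b <= b', c <= c' & d <= d'].
Proof.
apply/forallP/idP => [H|/and4P[Ha Hb Hc Hd] [[|[|[|[|//]]]] i4]]; rewrite ?mxE //=.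
by move: (H 0%R) (H 1%R) (H 2%:R%R) (H 3%:R%R); rewrite !mxE /= => -> -> -> ->.
Qed.

Lemma nat_comb_M_gens n a b c d :
  nat_comb (M_gens n) (vec4 a b c d) =
  (n * (a + b + c + d) + 3 * b + 4 * c + 5 * d,
   n * (a + b + c + d) + 2 * b + 3 * c + 3 * d).
Proof.
have natMn (p m : nat) : (p *+ m)%R = p * m by rewrite -mulr_natr !natrE.
rewrite /nat_comb !big_ord_recl big_ord0 !mxE /M_gens /Nvec /=.
by apply/pair_equal_spec; split; rewrite !(raddfD, raddfMn) /= !natMn !natrE; nia.
Qed.

(** The first equation compares the differences of the two coordinates, in which
    N cancels; the second compares the second coordinates. *)
Lemma ker_cong_M_gens k r a b c d a' b' c' d' :
  ker_cong (M_gens (3 * k + r)) (vec4 a b c d, vec4 a' b' c' d') <->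
  b + c + 2 * d = b' + c' + 2 * d' /\
  (3 * k + r) * (a + b + c + d) + 2 * b + 3 * c + 3 * d =
  (3 * k + r) * (a' + b' + c' + d') + 2 * b' + 3 * c' + 3 * d'.
Proof.
rewrite ker_congP !nat_comb_M_gens pair_equal_spec.
by split=> -[]; lia.
Qed.

(** The three conditions exclude, in order, the right sides of the three
    relations.  For r = 0 there is no third relation, and then the third
    condition follows from the first. *)
Definition reduced k r b c :=
  [&& b < 3, c < 2 * k + r & (b < 3 - r) || (c < 2 * k + r - 1)].

(** The differences of factorizations of one element form the lattice spanned by
    e = (1, -3, 1, 1) and f = (k + 1, r, - (2k + r), k).  With x e + y f the
    difference, y is the difference of the lengths, and may be taken
    nonnegative by symmetry.  The bounds on the two middle coordinates force
    x = 0 if y = 0, are contradictory if y >= 2, and leave at most x = 1 if y = 1;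
    the difference e + f is the third relation, which the third condition
    excludes. *)
Lemma reduced_unique k r a b c d a' b' c' d' : 0 < k -> r < 3 ->
  ker_cong (M_gens (3 * k + r)) (vec4 a b c d, vec4 a' b' c' d') ->
  reduced k r b c -> reduced k r b' c' ->
  vec4 a b c d = vec4 a' b' c' d'.
Proof.
move=> k0 r3.
wlog le_s : a b c d a' b' c' d' / a + b + c + d <= a' + b' + c' + d' => [H E R R'|].
  have [le|/ltnW le] := leqP (a + b + c + d) (a' + b' + c' + d'); first exact: H.
  by apply/esym/H => //; case: (ker_cong_congruence (M_gens (3 * k + r))) => _ S _ _; apply: S.
rewrite ker_cong_M_gens => -[E1 E2] /and3P[Hb Hc Hbc] /and3P[Hb' Hc' Hbc'].
(* y is the coefficient of f. *)
have [y Ey] : exists y, a' + b' + c' + d' = a + b + c + d + y.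
  by exists ((a' + b' + c' + d') - (a + b + c + d)); rewrite subnKC.
have E : (3 * k + r) * y + c' + d = d' + c by rewrite Ey mulnDr in E2; lia.
case: y => [|[|y]] in Ey E *.
- by have [-> -> -> ->] : [/\ a = a', b = b', c = c' & d = d'] by split; lia.
- lia.
- by rewrite !mulnS mulnDl in E; lia.
Qed.

Lemma congruence_rewrite C a b c d a' b' c' d' u0 u1 u2 u3 : congruence C ->
  C (vec4 a b c d, vec4 a' b' c' d') ->
  a' <= u0 -> b' <= u1 -> c' <= u2 -> d' <= u3 ->
  C (vec4 u0 u1 u2 u3,
     vec4 (a + (u0 - a')) (b + (u1 - b')) (c + (u2 - c')) (d + (u3 - d'))).
Proof.
case=> _ Csym _ Ctr H la lb lc ld.
have := Ctr _ _ (vec4 (u0 - a') (u1 - b') (u2 - c') (u3 - d')) (Csym _ _ H).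
by rewrite !vec4D !subnKC.
Qed.

(** Any relation that applies lowers b + c, so rewriting terminates; that a
    relation applies to every vector that is not reduced is how reducedness
    was chosen. *)
Lemma reduce k r C : 0 < k -> r < 3 -> congruence C -> rho_rel k r `<=` C ->
  forall a b c d, exists a' b' c' d',
    C (vec4 a b c d, vec4 a' b' c' d') /\ reduced k r b' c'.
Proof.
move=> k0 r3 Ccong rhoC a b c d.
have [m] := ubnP (b + c); elim: m => // m IH in a b c d * => lem.
have [R|nR] := boolP (reduced k r b c).
  by exists a, b, c, d; split=> //; case: Ccong.
have step x0 x1 x2 x3 y0 y1 y2 y3 :
    rho_rel k r (vec4 x0 x1 x2 x3, vec4 y0 y1 y2 y3) ->
    [&& y0 <= a, y1 <= b, y2 <= c & y3 <= d] -> x1 + x2 < y1 + y2 ->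
    exists a' b' c' d', C (vec4 a b c d, vec4 a' b' c' d') /\ reduced k r b' c'.
  move=> /rhoC H /and4P[l0 l1 l2 l3] lt.
  have H' := congruence_rewrite Ccong H l0 l1 l2 l3.
  have [|a' [b' [c' [d' [H'' R]]]]] := IH (x0 + (a - y0)) (x1 + (b - y1)) (x2 + (c - y2)) (x3 + (d - y3)).
    lia.
  exists a', b', c', d'; split=> //.
  by case: Ccong => _ _ Ctrans _; apply: Ctrans H' H''.
have rhoR p : R_rel k r p -> rho_rel k r p.
  by rewrite /rho_rel; case: ifP => // _; left.
move: nR; rewrite /reduced !negb_and negb_or -!leqNgt => /or3P[b3|ck|/andP[br ck]].
- apply: (step 1 0 1 1 0 3 0 0); [by apply: rhoR; left|lia|lia].
- apply: (step (k + 1) r 0 k 0 0 (2 * k + r) 0); [by apply: rhoR; right|lia|lia].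
- have [r0|r0] := posnP r.
    (* Here b >= 3 - r = 3, so the first relation applies. *)
    apply: (step 1 0 1 1 0 3 0 0); [by apply: rhoR; left|lia|lia].
  apply: (step (k + 2) 0 0 (k + 1) 0 (3 - r) (2 * k + r - 1) 0); [|lia|lia].
  by rewrite /rho_rel; case: r r0 {r3 rhoC step IH ck br rhoR} => // r _; right.
Qed.

Lemma smallest_congruence m (rho : set ('rV[nat]_m * 'rV[nat]_m)) :
  congruence (smallest (@congruence _) rho).
Proof.
split=> [x|x y H|x y z H H'|x y u H] C CC; case: (CC) => -[Crefl Csym Ctrans Ctr] _.
- exact: Crefl.
- exact: Csym (H C CC).
- exact: Ctrans (H C CC) (H' C CC).
- exact: Ctr (H C CC).
Qed.

(** The Rees congruence of the ideal of the vectors not below x. *)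
Lemma rees_congruence m (x : 'rV[nat]_m) :
  congruence [set p | p.1 = p.2 \/ ~~ dominated p.1 x /\ ~~ dominated p.2 x].
Proof.
have up (u w : 'rV[nat]_m) : ~~ dominated u x -> ~~ dominated (u + w)%R x.
  apply: contra => /forallP D; apply/forallP => i.
  by apply: leq_trans (D i); rewrite mxE leq_addr.
split=> /= [y|y z|y z t|y z u].
- by left.
- by case=> [->|[]]; [left|right].
- by case=> [->|[Hy Hz]] // [<-|[_ Ht]]; right.
- by case=> [->|[Hy Hz]]; [left|right; split; apply: up].
Qed.

(** The Rees congruence of the vectors not below p.2 contains sigma, and p.2 is
    alone in its class, so sigma cannot identify p.1 with p.2. *)
Lemma indispensable (V : nmodType) m (v : 'I_m -> V) rho sigma p :
  presentation v rho -> rho p -> sigma `<=` rho -> ~ sigma p -> p.1 <> p.2 ->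
  (forall q, rho q -> q = p \/ ~~ dominated q.1 p.2 /\ ~~ dominated q.2 p.2) ->
  ~ presentation v sigma.
Proof.
move=> [rhoK _] rp sr sp p12 rees [_ Es].
have : smallest (@congruence _) sigma p by rewrite Es; apply: rhoK.
case/(_ _ (conj (rees_congruence p.2) _))=> [q sq|//|[_ /negP[]]].
- by right; case: (rees q (sr _ sq)) => // Eq; rewrite -Eq in sp.
- by apply/forallP.
Qed.

Lemma rho_rel_presentation k r : 0 < k -> r < 3 ->
  presentation (M_gens (3 * k + r)) (rho_rel k r).
Proof.
move=> k0 r3.
have rhoK : rho_rel k r `<=` ker_cong (M_gens (3 * k + r)).
  move=> p; rewrite /rho_rel /R_rel; case: (posnP r) => [r0|r0].
    by move=> [->|->]; rewrite ker_cong_M_gens; nia.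
  by move=> -[[->|->]|->]; rewrite ker_cong_M_gens; nia.
split=> //; apply/seteqP; split.
  exact: smallest_sub (ker_cong_congruence _) rhoK.
case=> x y Kxy C [Ccong rhoC].
have [a [b [c [d Ex]]]] := vec4_eta x.
have [a' [b' [c' [d' Ey]]]] := vec4_eta y.
subst x y.
have smallestK := smallest_sub (ker_cong_congruence _) rhoK.
have cong_smallest := smallest_congruence (rho_rel k r).
have [_ Csym Ctrans _] := Ccong.
have [_ Ksym Ktrans _] := ker_cong_congruence (M_gens (3 * k + r)).
have red := reduce k0 r3 cong_smallest (@sub_gen_smallest _ _ _).
have [u0 [u1 [u2 [u3 [Su Ru]]]]] := red a b c d.
have [w0 [w1 [w2 [w3 [Sw Rw]]]]] := red a' b' c' d'.
have Euw : vec4 u0 u1 u2 u3 = vec4 w0 w1 w2 w3.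
  apply: (reduced_unique k0 r3) Ru Rw.
  exact: Ktrans (Ksym _ _ (smallestK _ Su)) (Ktrans _ _ _ Kxy (smallestK _ Sw)).
apply: Ctrans (Su C (conj Ccong rhoC)) _; rewrite Euw.
exact: Csym _ _ (Sw C (conj Ccong rhoC)).
Qed.

Theorem theorem5p2 (n k r : nat) (hn : (3 <= n)%N) (hnk : n = (3 * k + r)%N)
    (hr : (r < 3)%N) :
  minimal_presentation (M_gens n) (rho_rel k r).
Proof.
have k0 : 0 < k by lia.
subst n; have pres := rho_rel_presentation k0 hr.
split=> // sigma [sr /existsNP [p /not_implyP [rp sp]]].
apply: (indispensable pres rp sr sp).
  (* The two sides of every relation differ in the first coordinate. *)
  have sep a b c d a' b' c' d' : vec4 a b c d = vec4 a' b' c' d' -> a = a'.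
    by move/rowP/(_ 0%R); rewrite !mxE.
  move: rp; rewrite /rho_rel /R_rel.
  by case: ifP => _; [|case]; (move=> [->|->]) || move=> -> ; move/sep; lia.
move: rp; rewrite /rho_rel /R_rel; case: (posnP r) => [r0|r0].
  by move=> [->|->] q [->|->]; rewrite !dominated_vec4; (left; done) || (right; lia).
by move=> -[[->|->]|->] q [[->|->]|->]; rewrite !dominated_vec4; (left; reflexivity) || (right; lia).
Qed.
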